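(* Fix $\boldsymbol{\omega}\in\Omega_N^{\mathbb{R},+}$. Let $\lambda_*$ be a simple eigenvalue of $(\boldsymbol{\omega},\mathbf{A})$ for a self-adjoint boundary condition $\mathbf{A}$, let $y=\{y_n\}_{n=0}^{N+1}$ be a normalized eigenfunction for $\lambda_*$, and let $\Lambda$ be the continuous simple eigenvalue branch of $(\boldsymbol{\omega},\mathbf{B})$ for $\mathbf{B}\in\mathcal{B}^{\mathbb{C}}$ through $\lambda_*$. Then we have the following derivative formulas: (1) when $\mathbf{A}\in\mathcal{O}_{1,3}^{\mathbb{C}}$, $$d\Lambda\big|_{\mathbf{A}}(H\,|\,L)=(f_0\Delta\bar y_0,\ f_N\Delta\bar y_N)\begin{pmatrix}h_{12}&\bar h_{22}\\ h_{22}&l_{22}\end{pmatrix}\begin{pmatrix}f_0\Delta y_0\\ f_N\Delta y_N\end{pmatrix}$$ for all $(H\,|\,L)$ in $T_{\mathbf{A}}\mathcal{B}^{\mathbb{C}}=T_{\mathbf{A}}\mathcal{O}_{1,3}^{\mathbb{C}}=\left\{\begin{pmatrix}0&h_{12}&0&\bar h_{22}\\0&h_{22}&0&l_{22}\end{pmatrix}:h_{12},l_{22}\in\mathbb{R},\ h_{22}\in\mathbb{C}\right\}$; (2) when $\mathbf{A}\in\mathcal{O}_{1,4}^{\mathbb{C}}$, $$d\Lambda\big|_{\mathbf{A}}(H\,|\,L)=(f_0\Delta\bar y_0,\ \bar y_N)\begin{pmatrix}h_{12}&\bar h_{22}\\ h_{22}&l_{21}\end{pmatrix}\begin{pmatrix}f_0\Delta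 y_0\\ y_N\end{pmatrix}$$ for all $(H\,|\,L)$ in $T_{\mathbf{A}}\mathcal{B}^{\mathbb{C}}=T_{\mathbf{A}}\mathcal{O}_{1,4}^{\mathbb{C}}=\left\{\begin{pmatrix}0&h_{12}&\bar h_{22}&0\\0&h_{22}&l_{21}&0\end{pmatrix}:h_{12},l_{21}\in\mathbb{R},\ h_{22}\in\mathbb{C}\right\}$; (3) when $\mathbf{A}\in\mathcal{O}_{2,3}^{\mathbb{C}}$, $$d\Lambda\big|_{\mathbf{A}}(H\,|\,L)=(\bar y_0,\ f_N\Delta\bar y_N)\begin{pmatrix}h_{11}&\bar h_{21}\\ h_{21}&l_{22}\end{pmatrix}\begin{pmatrix}y_0\\ f_N\Delta y_N\end{pmatrix}$$ for all $(H\,|\,L)$ in $T_{\mathbf{A}}\mathcal{B}^{\mathbb{C}}=T_{\mathbf{A}}\mathcal{O}_{2,3}^{\mathbb{C}}=\left\{\begin{pmatrix}h_{11}&0&0&\bar h_{21}\\ h_{21}&0&0&l_{22}\end{pmatrix}:h_{11},l_{22}\in\mathbb{R},\ h_{21}\in\mathbb{C}\right\}$; (4) when $\mathbf{A}\in\mathcal{O}_{2,4}^{\mathbb{C}}$, $$d\Lambda\big|_{\mathbf{A}}(H\,|\,L)=(\bar y_0,\ \bar y_N)\begin{pmatrix}h_{11}&\bar h_{21}\\ h_{21}&l_{21}\end{pmatrix}\begin{pmatrix}y_0\\ y_N\end{pmatrix}$$ for all $(H\,|\,L)$ in $T_{\mathbf{A}}\mathcal{B}^{\mathbb{C}}=T_{\mathbf{A}}\mathcal{O}_{2,4}^{\mathbb{C}}=\left\{\begin{pmatrix}h_{11}&0&\bar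 h_{21}&0\\ h_{21}&0&l_{21}&0\end{pmatrix}:h_{11},l_{21}\in\mathbb{R},\ h_{21}\in\mathbb{C}\right\}$.
   Context: $N\ge2$ is an integer, $\Delta y_n=y_{n+1}-y_n$, $\nabla y_n=y_n-y_{n-1}$. A discrete Sturm-Liouville equation $-\nabla(f_n\Delta y_n)+q_ny_n=\lambda w_ny_n$, $1\le n\le N$, is identified with $\boldsymbol{\omega}=(1/f,q,w)$; $\Omega_N^{\mathbb{R},+}$ is the set of such triples with $f_0,\dots,f_N$ real and nonzero, $q_1,\dots,q_N$ real, and $w_1,\dots,w_N>0$. A boundary condition is $A\begin{pmatrix}y_0\\ f_0\Delta y_0\end{pmatrix}+B\begin{pmatrix}y_N\\ f_N\Delta y_N\end{pmatrix}=0$ with $A,B$ complex $2\times2$ matrices, $\mathrm{rank}(A,B)=2$; it is denoted $\mathbf{A}=[A\,|\,B]$, where $(A,B)$ and $(TA,TB)$, $T\in GL(2,\mathbb{C})$, are identified (quotient topology). $\mathcal{B}^{\mathbb{C}}$ is the space of self-adjoint boundary conditions, i.e. those with $AEA^*=BEB^*$, $E=\begin{pmatrix}0&1\\-1&0\end{pmatrix}$. It is a real-analytic manifold of dimension 4 covered by the relatively open charts (two real parameters and $z\in\mathbb{C}$, regarded as two real coordinates) $$\mathcal{O}_{1,3}^{\mathbb{C}}=\left\{\left[\begin{array}{cccc}1&a_{12}&0&\bar z\\0&z&-1&b_{22}\end{array}\right]\right\},\quad \mathcal{O}_{1,4}^{\mathbb{C}}=\left\{\left[\begin{array}{cccc}1&a_{12}&\bar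 z&0\\0&z&b_{21}&1\end{array}\right]\right\},$$ $$\mathcal{O}_{2,3}^{\mathbb{C}}=\left\{\left[\begin{array}{cccc}a_{11}&-1&0&\bar z\\ z&0&-1&b_{22}\end{array}\right]\right\},\quad \mathcal{O}_{2,4}^{\mathbb{C}}=\left\{\left[\begin{array}{cccc}a_{11}&-1&\bar z&0\\ z&0&b_{21}&1\end{array}\right]\right\}.$$ In each chart, tangent vectors $(H\,|\,L)$ are the ($\mathbb{R}$-linear) infinitesimal variations of the displayed normalized matrix. A number $\lambda$ is an eigenvalue of the problem if there is a nonzero complex sequence $y=\{y_n\}_{n=0}^{N+1}$ (an eigenfunction) satisfying both the equation and the boundary condition; for self-adjoint problems eigenvalues are real. An eigenfunction is normalized if $\sum_{n=1}^Nw_n|y_n|^2=1$. Let $\phi(\lambda),\psi(\lambda)$ be the solutions of the equation with $\phi_0=1$, $f_0\Delta\phi_0=0$, $\psi_0=0$, $f_0\Delta\psi_0=1$, and $\Phi_N(\lambda)=\begin{pmatrix}\phi_N&\psi_N\\ f_N\Delta\phi_N&f_N\Delta\psi_N\end{pmatrix}$; an eigenvalue is simple if it is a zero of order $1$ of the polynomial $\Gamma(\lambda)=\det(A+B\Phi_N(\lambda))$. The continuous simple eigenvalue branch over $\mathcal{B}^{\mathbb{C}}$ through $\lambda_*$ ($\boldsymbol{\omega}$ fixed): a continuous real function $\Lambda$ on a connected neighborhood of $\mathbf{A}$ in $\mathcal{B}^{\mathbb{C}}$ with $\Lambda(\mathbf{A})=\lambda_*$ such that $\Lambda(\mathbf{B})$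 is a simple eigenvalue of $(\boldsymbol{\omega},\mathbf{B})$ for each $\mathbf{B}$ in that neighborhood (it exists and is locally unique). *)

(* Defs.v *)
From HB Require Import structures.
From mathcomp Require Import all_boot all_order all_algebra.
From mathcomp Require Import all_classical all_reals all_analysis.
From mathcomp Require Import complex.

Set Implicit Arguments.
Unset Strict Implicit.
Unset Printing Implicit Defensive.

Import Order.TTheory GRing.Theory Num.Theory.
Import numFieldNormedType.Exports.

Local Open Scope classical_set_scope.
Local Open Scope ring_scope.
Local Open Scope complex_scope.
Local Open Scope quotient_scope.

(* The usual topology of the complex numbers, given by the modulus. *)
#[warnings="-redundant-canonical-projection"]
HB.instance Definition _ (R : realType) := NormedModule.copy R[i] R[i]^o.

Definition mxlist (K : nzRingType) (m n : nat) (s : seq (seq K)) : 'M[K]_(m, n) :=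
  \matrix_(i < m, j < n) nth 0 (nth [::] s i) j.

(* The triple is stored through [f] rather than [1/f].  Only f_0, ..., f_N,
   q_1, ..., q_N and w_1, ..., w_N are ever used. *)
Record SLcoef (R : realType) := SLCoef {
  SLf : nat -> R;
  SLq : nat -> R;
  SLw : nat -> R
}.

Definition Omega (R : realType) (N : nat) : set (SLcoef R) :=
  [set o | (forall n, (n <= N)%N -> SLf o n != 0) /\
           (forall n, (1 <= n <= N)%N -> 0 < SLw o n)].

(* f_n Delta y_n *)
Definition fDelta (R : realType) (o : SLcoef R) (y : nat -> R[i]) (n : nat) : R[i] :=
  (SLf o n)%:C * (y n.+1 - y n).

Definition SLequation (R : realType) (N : nat) (o : SLcoef R) (lam : R[i])
    (y : nat -> R[i]) : Prop :=
  forall n, (1 <= n <= N)%N ->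
    - (fDelta o y n - fDelta o y n.-1) + (SLq o n)%:C * y n
    = lam * (SLw o n)%:C * y n.

Definition normalized (R : realType) (N : nat) (o : SLcoef R)
    (y : nat -> R[i]) : Prop :=
  \sum_(1 <= n < N.+1) (SLw o n)%:C * `|y n| ^+ 2 = 1.

(* The pair (y_n, f_n Delta y_n) as polynomials in lambda = 'X, for the solution
   with y_0 = a and f_0 Delta y_0 = b; see [SLsol_equation]. *)
Fixpoint SLsol (R : realType) (o : SLcoef R) (a b : R[i]) (n : nat) :
    {poly R[i]} * {poly R[i]} :=
  if n is m.+1 then
    let: (u, v) := SLsol o a b m in
    let u' := u + ((SLf o m)%:C^-1)%:P * v in
    (u', v + ((SLq o n)%:C%:P - (SLw o n)%:C *: 'X) * u')
  else (a%:P, b%:P).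

Lemma SLsol_equation (R : realType) (N : nat) (o : SLcoef R) (a b lam : R[i]) :
  Omega N o ->
  let y n := (SLsol o a b n).1.[lam] in
  [/\ SLequation N o lam y, y 0%N = a, fDelta o y 0%N = b &
      forall n, (n <= N)%N -> fDelta o y n = (SLsol o a b n).2.[lam]].
Proof.
move=> [f0 _] y.
have fE n : (n <= N)%N -> fDelta o y n = (SLsol o a b n).2.[lam].
  move=> nN; rewrite /fDelta /y /=; case: (SLsol o a b n) => u v /=.
  rewrite hornerD hornerCM addrAC subrr add0r mulrA divff ?mul1r//.
  by rewrite (fmorph_eq0 (real_complex R)) f0.
split=> //; last 2 first.
- by rewrite /y /= hornerC.
- by rewrite fE //= hornerC.
case=> // n /= nN; rewrite !fE //; last exact: ltnW.
rewrite /y /=; case: (SLsol o a b n) => u v /=.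
set u' := u + _; rewrite hornerD hornerM hornerD hornerN hornerC hornerZ hornerX.
rewrite [v.[lam] + _]addrC addrK mulrBl opprB subrK.
by rewrite [lam * _]mulrC.
Qed.

(* Polynomial in lambda, entrywise *)
Definition PhiN (R : realType) (N : nat) (o : SLcoef R) : 'M[{poly R[i]}]_2 :=
  let phi := SLsol o 1 0 N in
  let psi := SLsol o 0 1 N in
  mxlist 2 2 [:: [:: phi.1; psi.1]; [:: phi.2; psi.2]].

(* (A, B) is encoded as the block row matrix (A | B). *)
Definition rank_two (R : realType) : set 'M[R[i]]_(2, 2 + 2) :=
  [set M | \rank M = 2%N].

Definition bc_matrix (R : realType) : topologicalType := set_type (@rank_two R).

Definition bc_rel (R : realType) (M M' : bc_matrix R) : bool :=
  `[< exists2 T : 'M[R[i]]_2, T \in unitmx & val M' = T *m val M >].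

Lemma bc_rel_equiv (R : realType) : equiv_class_of (@bc_rel R).
Proof.
split=> [M|M M'|M2 M1 M3].
- by apply/asboolP; exists 1%:M; rewrite ?unitmx1 ?mul1mx.
- apply/idP/idP => /asboolP[T Tu eT]; apply/asboolP; exists (invmx T);
    by rewrite ?unitmx_inv// eT mulKmx.
- move=> /asboolP[T Tu eT] /asboolP[T' Tu' eT']; apply/asboolP.
  by exists (T' *m T); rewrite ?unitmx_mul ?Tu ?Tu'// eT' eT mulmxA.
Qed.

Canonical bc_equivalence (R : realType) := EquivRelPack (@bc_rel_equiv R).

Definition bcspace (R : realType) : topologicalType :=
  quotient_topology {eq_quot @bc_equivalence R}.

Definition bcA (R : realType) (b : bcspace R) : 'M[R[i]]_2 := lsubmx (val (repr b)).
Definition bcB (R : realType) (b : bcspace R) : 'M[R[i]]_2 := rsubmx (val (repr b)).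

Definition Emx (R : realType) : 'M[R[i]]_2 :=
  mxlist 2 2 [:: [:: 0; 1]; [:: -1; 0]].

Definition adjmx (R : realType) (m n : nat) (M : 'M[R[i]]_(m, n)) : 'M[R[i]]_(n, m) :=
  (map_mx Num.conj M)^T.

Definition sa_matrix (R : realType) (M : 'M[R[i]]_(2, 2 + 2)) : Prop :=
  lsubmx M *m Emx R *m adjmx (lsubmx M) = rsubmx M *m Emx R *m adjmx (rsubmx M).

(* The condition does not depend on the representative; see [sa_matrixP]. *)
Definition selfadjoint (R : realType) : set (bcspace R) :=
  [set b | sa_matrix (val (repr b))].

Definition bcclass (R : realType) (M : 'M[R[i]]_(2, 2 + 2)) (rM : rank_two M) : bcspace R :=
  \pi_(bcspace R) (exist _ M (mem_set rM) : bc_matrix R).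

Lemma bc_repr (R : realType) (M : 'M[R[i]]_(2, 2 + 2)) (rM : rank_two M) :
  exists2 T : 'M[R[i]]_2, T \in unitmx & val (repr (bcclass rM)) = T *m M.
Proof.
have /eqmodP/= /asboolP[T Tu eT] :
  \pi_{eq_quot @bc_equivalence R} (exist _ M (mem_set rM) : bc_matrix R) =
  \pi_{eq_quot @bc_equivalence R} (repr (bcclass rM)).
  exact/esym/reprK.
by exists T.
Qed.

Lemma sa_matrix_mul (R : realType) (T : 'M[R[i]]_2) (M : 'M[R[i]]_(2, 2 + 2)) :
  T \in unitmx -> sa_matrix (T *m M) <-> sa_matrix M.
Proof.
move=> Tu; rewrite /sa_matrix -!mulmx_lsub -!mulmx_rsub.
have eT (N : 'M[R[i]]_2) :
    (T *m N) *m Emx R *m adjmx (T *m N) = T *m (N *m Emx R *m adjmx N) *m adjmx T.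
  by rewrite /adjmx map_mxM trmx_mul !mulmxA.
have Tu' : adjmx T \in unitmx by rewrite /adjmx unitmx_tr map_unitmx.
rewrite !eT; split=> [e|->//].
by rewrite -[LHS](mulKmx Tu) -[RHS](mulKmx Tu) -[in LHS](mulmxK Tu' (T *m _))
  -[in RHS](mulmxK Tu' (T *m _)) e.
Qed.

Lemma sa_matrixP (R : realType) (M : 'M[R[i]]_(2, 2 + 2)) (rM : rank_two M) :
  selfadjoint (bcclass rM) <-> sa_matrix M.
Proof.
by rewrite /selfadjoint /=; have [T Tu ->] := bc_repr rM; exact: sa_matrix_mul.
Qed.

(* The space B^C, with the topology induced by that of [bcspace R] *)
Definition sabc (R : realType) : topologicalType := set_type (@selfadjoint R).

Definition bc_holds (R : realType) (N : nat) (o : SLcoef R) (b : bcspace R)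
    (y : nat -> R[i]) : Prop :=
  bcA b *m mxlist 2 1 [:: [:: y 0%N]; [:: fDelta o y 0%N]]
  + bcB b *m mxlist 2 1 [:: [:: y N]; [:: fDelta o y N]] = 0.

Definition eigenfunction (R : realType) (N : nat) (o : SLcoef R) (b : bcspace R)
    (lam : R[i]) (y : nat -> R[i]) : Prop :=
  [/\ exists2 n, (n <= N.+1)%N & y n != 0,
      SLequation N o lam y & bc_holds N o b y].

Definition SLeigenvalue (R : realType) (N : nat) (o : SLcoef R) (b : bcspace R)
    (lam : R[i]) : Prop :=
  exists y, eigenfunction N o b lam y.

(* Changing the representative multiplies Gamma by a nonzero constant. *)
Definition Gamma (R : realType) (N : nat) (o : SLcoef R) (b : bcspace R) : {poly R[i]} :=
  \det (map_mx polyC (bcA b) + map_mx polyC (bcB b) *m PhiN N o).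

Definition simple_eigenvalue (R : realType) (N : nat) (o : SLcoef R) (b : bcspace R)
    (lam : R[i]) : Prop :=
  SLeigenvalue N o b lam /\ mup lam (Gamma N o b) = 1%N.

Definition simple_branch (R : realType) (N : nat) (o : SLcoef R) (A : sabc R)
    (lam : R) (U : set (sabc R)) (Lambda : sabc R -> R) : Prop :=
  [/\ nbhs A U, connected U, {within U, continuous Lambda}, Lambda A = lam &
      forall B, U B -> simple_eigenvalue N o (val B) (Lambda B)%:C].

(* Coordinates (s, t, (x, y)): s and t are the two real parameters, in order of
   appearance in the normalized matrix, and z = x + i y. *)
Definition chart_param (R : realType) : normedModType R := (R * R * (R * R))%type.

Definition mk_sabc (R : realType) (M : 'M[R[i]]_(2, 2 + 2)) (rM : rank_two M)
    (sM : sa_matrix M) : sabc R :=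
  exist _ (bcclass rM) (mem_set ((sa_matrixP rM).2 sM)).

Lemma rank2_right_inverse (R : realType) (M : 'M[R[i]]_(2, 2 + 2))
    (M' : 'M[R[i]]_(2 + 2, 2)) : M *m M' = 1%:M -> rank_two M.
Proof.
move=> MM'; apply/eqP; rewrite eqn_leq rank_leq_row /=.
have := mxrankM_maxl M M'; rewrite MM' mxrank1; exact.
Qed.

Section Charts.
Variable R : realType.
Implicit Type p : chart_param R.

Definition cs p : R[i] := p.1.1%:C.
Definition ct p : R[i] := p.1.2%:C.
Definition cz p : R[i] := p.2.1 +i* p.2.2.

Lemma csK p : Num.conj (cs p) = cs p.
Proof. by rewrite /cs [LHS]conjc_real. Qed.

Lemma ctK p : Num.conj (ct p) = ct p.
Proof. by rewrite /ct [LHS]conjc_real. Qed.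

Definition mx13 p : 'M[R[i]]_(2, 2 + 2) :=
  mxlist 2 (2 + 2) [:: [:: 1; cs p; 0; Num.conj (cz p)];
                       [:: 0; cz p; -1; ct p]].
Definition mx14 p : 'M[R[i]]_(2, 2 + 2) :=
  mxlist 2 (2 + 2) [:: [:: 1; cs p; Num.conj (cz p); 0];
                       [:: 0; cz p; ct p; 1]].
Definition mx23 p : 'M[R[i]]_(2, 2 + 2) :=
  mxlist 2 (2 + 2) [:: [:: cs p; -1; 0; Num.conj (cz p)];
                       [:: cz p; 0; -1; ct p]].
Definition mx24 p : 'M[R[i]]_(2, 2 + 2) :=
  mxlist 2 (2 + 2) [:: [:: cs p; -1; Num.conj (cz p); 0];
                       [:: cz p; 0; ct p; 1]].

Local Ltac entrywise :=
  apply/matrixP => -[[|[|?]]//= ?] [[|[|?]]//= ?];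
  rewrite /adjmx /Emx /mxlist !(mxE, big_ord_recl, big_ord0) /=;
  rewrite ?(rmorph0, rmorph1, rmorphN1, mulr0, mul0r, mulr1, mulrN1, mul1r, mulN1r,
    opprK, oppr0, addr0, add0r) ?csK ?ctK ?conjCK ?subrr ?addNr.

Lemma mx13_rank2 p : rank_two (mx13 p).
Proof.
pose M' : 'M[R[i]]_(2 + 2, 2) :=
  mxlist _ _ [:: [:: 1; 0]; [:: 0; 0]; [:: 0; -1]; [:: 0; 0]].
by apply: (@rank2_right_inverse _ _ M'); entrywise.
Qed.

Lemma mx13_sa p : sa_matrix (mx13 p).
Proof. by entrywise. Qed.

Lemma mx14_rank2 p : rank_two (mx14 p).
Proof.
pose M' : 'M[R[i]]_(2 + 2, 2) :=
  mxlist _ _ [:: [:: 1; 0]; [:: 0; 0]; [:: 0; 0]; [:: 0; 1]].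
by apply: (@rank2_right_inverse _ _ M'); entrywise.
Qed.

Lemma mx14_sa p : sa_matrix (mx14 p).
Proof. by entrywise. Qed.

Lemma mx23_rank2 p : rank_two (mx23 p).
Proof.
pose M' : 'M[R[i]]_(2 + 2, 2) :=
  mxlist _ _ [:: [:: 0; 0]; [:: -1; 0]; [:: 0; -1]; [:: 0; 0]].
by apply: (@rank2_right_inverse _ _ M'); entrywise.
Qed.

Lemma mx23_sa p : sa_matrix (mx23 p).
Proof. by entrywise. Qed.

Lemma mx24_rank2 p : rank_two (mx24 p).
Proof.
pose M' : 'M[R[i]]_(2 + 2, 2) :=
  mxlist _ _ [:: [:: 0; 0]; [:: -1; 0]; [:: 0; 0]; [:: 0; 1]].
by apply: (@rank2_right_inverse _ _ M'); entrywise.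
Qed.

Lemma mx24_sa p : sa_matrix (mx24 p).
Proof. by entrywise. Qed.

Definition pt13 p : sabc R := mk_sabc (mx13_rank2 p) (mx13_sa p).
Definition pt14 p : sabc R := mk_sabc (mx14_rank2 p) (mx14_sa p).
Definition pt23 p : sabc R := mk_sabc (mx23_rank2 p) (mx23_sa p).
Definition pt24 p : sabc R := mk_sabc (mx24_rank2 p) (mx24_sa p).

End Charts.

Arguments mx13 {R} p.
Arguments mx14 {R} p.
Arguments mx23 {R} p.
Arguments mx24 {R} p.
Arguments pt13 {R} p.
Arguments pt14 {R} p.
Arguments pt23 {R} p.
Arguments pt24 {R} p.

(* Entrywise derivative of the normalized matrix [mx] at [p] along [h] *)
Definition chart_variation (R : realType) (mx : chart_param R -> 'M[R[i]]_(2, 2 + 2))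
    (p h : chart_param R) : 'M[R[i]]_(2, 2 + 2) :=
  \matrix_(i, j) ('D_h (fun p' => complex.Re (mx p' i j)) p +i*
                  'D_h (fun p' => complex.Im (mx p' i j)) p).

Definition tangent_space (R : realType) (mx : chart_param R -> 'M[R[i]]_(2, 2 + 2))
    (p : chart_param R) : set 'M[R[i]]_(2, 2 + 2) :=
  range (chart_variation mx p).

(* The differential at the point with coordinates [p], applied to the tangent
   vector (H | L) = [HL]: [xget] recovers the coordinates of [HL]. *)
Definition dchart (R : realType) (mx : chart_param R -> 'M[R[i]]_(2, 2 + 2))
    (pt : chart_param R -> sabc R) (Lambda : sabc R -> R) (p : chart_param R)
    (HL : 'M[R[i]]_(2, 2 + 2)) : R :=
  'd (Lambda \o pt) p (xget 0 [set h | chart_variation mx p h = HL]).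

(* Main.v *)
Require Import Defs.
From HB Require Import structures.
From mathcomp Require Import all_boot all_order all_algebra.
From mathcomp Require Import all_classical all_reals all_analysis.
From mathcomp Require Import complex ring.

Set Implicit Arguments.
Unset Strict Implicit.
Unset Printing Implicit Defensive.

Import Order.TTheory GRing.Theory Num.Theory.
Import numFieldNormedType.Exports.

Local Open Scope classical_set_scope.
Local Open Scope ring_scope.
Local Open Scope complex_scope.

(** The derivative is read off an exact difference formula, so neither the
    implicit function theorem nor the derivative of the characteristic
    polynomial [Gamma] is involved.

    Let p be the coordinates of the given condition in one of the charts, h a
    small displacement, mu(h) the value of the branch at h + p, and v(h) a
    solution at mu(h) satisfying the condition with coordinates h + p.
    Summation by parts ([lagrange_identity]) gives
      (mu(h) - lam) * sum_n w_n v(h)_n conj(y_n) = W_N - W_0,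
    where W_n = conj(f_n Delta y_n) v(h)_n - f_n Delta v(h)_n conj(y_n).  The
    right side only sees the boundary values of y and v(h).  In each chart the
    boundary condition expresses two of the four boundary values linearly in
    the other two, with a coefficient matrix that is Hermitian up to signs;
    after substitution the contributions of p cancel, and what remains is the
    Hermitian form of the theorem, with coefficients linear in h, evaluated at
    the pair (y, v(h)) ([mx13_boundary_form] and its three analogues).

    It remains to choose v(h) depending continuously on h, with v(0) = y.  A
    solution is determined by its initial data c, and it satisfies the boundary
    condition if and only if c is in the kernel of the 2 x 2 matrix
    C(h) = A + B Phi_N(mu(h)), whose determinant vanishes.  Simplicity of lam
    forces C(0) to be nonzero ([simple_char_matrix]), so its kernel is a line
    and the initial data of y are the image of some vector e under the adjugate
    of C(0) ([kernel_adj2]).  The adjugate of C(h) applied to the same e is then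
    the wanted continuous choice ([eigenfunction_family]).

    The sum on the left tends to the squared norm of y, which is 1, so
    mu(h) - lam is a real-linear form in h whose coefficients converge as h
    tends to 0.  This is differentiability, with the limit form as differential
    ([slope_differentiable], [chart_derivative]). *)

(** * Limits of complex-valued functions *)

Section ComplexLimits.
Variable R : realType.
Context {T : Type} {F : set_system T} {FF : Filter F}.
Implicit Types (f : T -> R[i]) (a : R[i]).

Lemma cvg_real_complex (f : T -> R) (a : R) :
  f x @[x --> F] --> a -> (f x)%:C @[x --> F] --> a%:C.
Proof.
move=> /cvgrPdist_lt fa; apply/cvgrPdist_lt => -[e e'] /=.
rewrite ltcE /= => /andP[/eqP ->] e0; apply: filterS (fa e e0) => x.
by rewrite -rmorphB normc_def /= expr0n addr0 sqrtr_sqr ltcR.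
Qed.

Lemma cvg_Re f a :
  f x @[x --> F] --> a -> complex.Re (f x) @[x --> F] --> complex.Re a.
Proof.
move=> /cvgrPdist_lt fa; apply/cvgrPdist_lt => e e0.
have e0' : 0 < e%:C by rewrite ltcR.
apply: filterS (fa _ e0') => x; rewrite -raddfB -ltcR /=.
exact/le_lt_trans/normc_ge_Re.
Qed.

Lemma cvg_conj f a :
  f x @[x --> F] --> a -> Num.conj (f x) @[x --> F] --> Num.conj a.
Proof.
move=> /cvgrPdist_lt fa; apply/cvgrPdist_lt => e e0.
by apply: filterS (fa e e0) => x; rewrite -rmorphB norm_conjC.
Qed.

Lemma cvg_horner (p : {poly R[i]}) f a :
  f x @[x --> F] --> a -> p.[f x] @[x --> F] --> p.[a].
Proof.
move=> fa; elim/poly_ind: p => [|p c IHp].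
  by under eq_fun do rewrite horner0; rewrite horner0; exact: cvg_cst.
under eq_fun do rewrite hornerMXaddC; rewrite hornerMXaddC.
exact: cvgD (cvgM IHp fa) (cvg_cst c).
Qed.

End ComplexLimits.

(** * Differentiability from converging slopes *)

Section Differentials.
Variable R : realType.
Implicit Types (p h : chart_param R).

Definition chart_linear (c1 c2 c3 c4 : R) h : R :=
  c1 * h.1.1 + c2 * h.1.2 + c3 * h.2.1 + c4 * h.2.2.

Lemma chart_linear_is_linear c1 c2 c3 c4 :
  linear (chart_linear c1 c2 c3 c4 : chart_param R -> R^o).
Proof.
move=> k h h'; rewrite /chart_linear /= /GRing.scale /=.
ring.
Qed.

HB.instance Definition _ c1 c2 c3 c4 :=
  GRing.isLinear.Build R (chart_param R) R^o _ (chart_linear c1 c2 c3 c4)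
    (@chart_linear_is_linear c1 c2 c3 c4).

Lemma cvg_translate p : h + p @[h --> (0 : chart_param R)] --> p.
Proof.
by rewrite -[X in _ --> X]add0r; apply: cvgD; [exact: cvg_id|exact: cvg_cst].
Qed.

Lemma cvg_chart_coords p :
  [/\ h.1.1 @[h --> p] --> p.1.1, h.1.2 @[h --> p] --> p.1.2,
      h.2.1 @[h --> p] --> p.2.1 & h.2.2 @[h --> p] --> p.2.2].
Proof.
have c1 : h.1 @[h --> p] --> p.1 by exact: cvg_fst.
have c2 : h.2 @[h --> p] --> p.2 by exact: cvg_snd.
split.
- exact: (cvg_comp _ _ c1 (@cvg_fst _ _ _ _ _)).
- exact: (cvg_comp _ _ c1 (@cvg_snd _ _ _ _ _)).
- exact: (cvg_comp _ _ c2 (@cvg_fst _ _ _ _ _)).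
- exact: (cvg_comp _ _ c2 (@cvg_snd _ _ _ _ _)).
Qed.

Lemma chart_linear_continuous c1 c2 c3 c4 :
  continuous (chart_linear c1 c2 c3 c4 : chart_param R -> R^o).
Proof.
move=> p; have [cs' ct' cx cy] := cvg_chart_coords p.
by apply: cvgD; [apply: cvgD; [apply: cvgD|]|]; apply: cvgM => //; exact: cvg_cst.
Qed.

Lemma chart_coord_le h :
  [/\ `|h.1.1| <= `|h|, `|h.1.2| <= `|h|, `|h.2.1| <= `|h| & `|h.2.2| <= `|h|].
Proof.
by case: h => [[a b] [c d]]; split; rewrite !prod_normE /= !le_max lexx ?orbT.
Qed.

(** Caratheodory's criterion: an increment that is linear in the displacement,
    with coefficients converging at 0, differs from the limit linear form by
    o(h). *)
Lemma slope_differentiable (f : chart_param R -> R) p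
    (g1 g2 g3 g4 : chart_param R -> R) c1 c2 c3 c4 :
  g1 h @[h --> 0] --> c1 -> g2 h @[h --> 0] --> c2 ->
  g3 h @[h --> 0] --> c3 -> g4 h @[h --> 0] --> c4 ->
  (\forall h \near 0, f (h + p) - f p = chart_linear (g1 h) (g2 h) (g3 h) (g4 h) h) ->
  differentiable f p /\ 'd f p = chart_linear c1 c2 c3 c4 :> (_ -> _).
Proof.
move=> g1c g2c g3c g4c fE.
have fo : f \o shift p = cst (f p) + chart_linear c1 c2 c3 c4 +o_ 0 id.
  apply/eqaddoP => e e0.
  have e4 : 0 < e / 4 by rewrite divr_gt0.
  move/cvgrPdist_le/(_ _ e4) : g1c => g1c.
  move/cvgrPdist_le/(_ _ e4) : g2c => g2c.
  move/cvgrPdist_le/(_ _ e4) : g3c => g3c.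
  move/cvgrPdist_le/(_ _ e4) : g4c => g4c.
  near=> h.
  have [l1 l2 l3 l4] := chart_coord_le h.
  have -> : (f \o shift p - (cst (f p) + chart_linear c1 c2 c3 c4)) h =
     chart_linear (g1 h - c1) (g2 h - c2) (g3 h - c3) (g4 h - c4) h.
    transitivity (f (h + p) - f p - chart_linear c1 c2 c3 c4 h).
      by rewrite -addrA -opprD.
    by rewrite (near fE h) // /chart_linear; ring.
  rewrite /chart_linear.
  have -> : e * `|id h| = e / 4 * `|h| + e / 4 * `|h| + e / 4 * `|h| + e / 4 * `|h|.
    by rewrite /=; field.
  do 3 (apply: le_trans (ler_normD _ _) _; apply: lerD; [|by rewrite normrM ler_pM // distrC; near: h]).
  by rewrite normrM ler_pM // distrC; near: h.
have dfE := diff_unique (@chart_linear_continuous c1 c2 c3 c4) fo.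
split=> //; apply/diff_locallyxP; rewrite dfE.
split=> [|h]; first exact: chart_linear_continuous.
by rewrite -[LHS]/((f \o shift p) h) fo.
Unshelve. all: by end_near. Qed.

End Differentials.

(** * Solutions of the difference equation *)

Section Solutions.
Variables (R : realType) (N : nat) (o : SLcoef R).
Hypothesis oO : Omega N o.
Implicit Types (y v : nat -> R[i]) (lam mu a b : R[i]).

Lemma SLsol_linear a b n :
  (SLsol o a b n).1 = a *: (SLsol o 1 0 n).1 + b *: (SLsol o 0 1 n).1 /\
  (SLsol o a b n).2 = a *: (SLsol o 1 0 n).2 + b *: (SLsol o 0 1 n).2.
Proof.
elim: n => [|n] /=.
  by rewrite -!mul_polyC polyC0 polyC1; split; ring.
case: (SLsol o a b n) (SLsol o 1 0 n) (SLsol o 0 1 n) => [u v] [u1 v1] [u2 v2].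
move=> /= [-> ->]; rewrite -!mul_polyC.
by split; ring.
Qed.

Lemma SLf_neq0 n : (n <= N)%N -> (SLf o n)%:C != 0 :> R[i].
Proof. by move=> nN; rewrite (fmorph_eq0 (real_complex R)) oO.1. Qed.

Lemma SLsol_unique lam y n : SLequation N o lam y -> (n <= N)%N ->
  y n = (SLsol o (y 0%N) (fDelta o y 0%N) n).1.[lam] /\
  fDelta o y n = (SLsol o (y 0%N) (fDelta o y 0%N) n).2.[lam].
Proof.
move=> ySL; elim: n => [|n IHn] nN /=; first by rewrite !hornerC.
have {IHn} := IHn (ltnW nN).
case: (SLsol o _ _ n) => u v /= [yu yv].
have yS : y n.+1 = u.[lam] + (SLf o n)%:C^-1 * v.[lam].
  rewrite -yu -yv /fDelta mulKf ?SLf_neq0 //; last exact: ltnW.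
  by rewrite addrC subrK.
have := ySL n.+1 nN; rewrite /= yv => e.
rewrite !(hornerE, hornerXn) /= -yS; split=> //.
have -> : fDelta o y n.+1 =
  v.[lam] + (SLq o n.+1)%:C * y n.+1
  - (- (fDelta o y n.+1 - v.[lam]) + (SLq o n.+1)%:C * y n.+1) by ring.
by rewrite e; ring.
Qed.

(** Summation by parts: (mu - lam) times the n-th summand is W n - W n.-1, and
    the sum telescopes. *)
Lemma lagrange_identity lam mu y v :
  Num.conj lam = lam -> SLequation N o lam y -> SLequation N o mu v ->
  let W n := Num.conj (fDelta o y n) * v n - fDelta o v n * Num.conj (y n) in
  (mu - lam) * \sum_(1 <= n < N.+1) (SLw o n)%:C * v n * Num.conj (y n) =
  W N - W 0%N.
Proof.
move=> lamR ySL vSL W; rewrite big_add1 /= -telescope_sumr // mulr_sumr.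
apply: eq_big_nat => n /= nN.
have cR (x : R) : Num.conj (x%:C : R[i]) = x%:C by exact: conjc_real.
have cfD m : Num.conj (fDelta o y m) =
    (SLf o m)%:C * (Num.conj (y m.+1) - Num.conj (y m)).
  by rewrite /fDelta rmorphM rmorphB /= cR.
have /(congr1 Num.conj) := ySL n.+1 nN; have := vSL n.+1 nN => ev.
rewrite /= rmorphD rmorphN rmorphB /= !cfD !rmorphM /= lamR !cR => ey.
have -> : (mu - lam) * ((SLw o n.+1)%:C * v n.+1 * Num.conj (y n.+1)) =
  (mu * (SLw o n.+1)%:C * v n.+1) * Num.conj (y n.+1) -
  (lam * (SLw o n.+1)%:C * Num.conj (y n.+1)) * v n.+1 by ring.
rewrite -ev -ey /W /= !cfD.
have -> : fDelta o v n = (SLf o n)%:C * (v n.+1 - v n) by [].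
by ring.
Qed.

End Solutions.


(** * Kernels of singular two-by-two matrices *)

Lemma big_ord2 (V : nmodType) (F : 'I_2 -> V) : \sum_(i < 2) F i = F 0 + F 1.
Proof.
by rewrite big_ord_recl big_ord1; congr (_ + F _); exact: val_inj.
Qed.

Lemma ord2_cases (i : 'I_2) : i = 0 \/ i = 1.
Proof. by case: i => -[|[|//]] ? /=; [left|right]; exact: val_inj. Qed.

Section TwoByTwo.
Variable K : fieldType.
Implicit Types (M : 'M[K]_2) (c : 'cV[K]_2).

(** The adjugate, with explicit entries so that its continuity in M is
    immediate. *)
Definition adj2 M : 'M[K]_2 := mxlist 2 2 [:: [:: M 1 1; - M 0 1]; [:: - M 1 0; M 0 0]].

Lemma det_mx2 M : \det M = M 0 0 * M 1 1 - M 0 1 * M 1 0.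
Proof.
rewrite (expand_det_row _ 0) big_ord2 /cofactor !det_mx11 !mxE.
rewrite /= expr0 expr1 mul1r mulN1r mulrN.
by congr (M _ _ * M _ _ - M _ _ * M _ _); exact: val_inj.
Qed.

Lemma mul_adj2 M : M *m adj2 M = (\det M)%:M.
Proof.
apply/matrixP => i j; rewrite det_mx2 !mxE big_ord2 !mxE.
by case: (ord2_cases i) => ->; case: (ord2_cases j) => -> /=;
  rewrite ?mulr1n ?mulr0n; ring.
Qed.

(** Each nonzero row (a, b) of M forces c to be proportional to (- b, a), which up
    to sign is a column of the adjugate; e records the factor. *)
Lemma kernel_adj2 M c : M != 0 -> M *m c = 0 -> exists e, c = adj2 M *m e.
Proof.
move=> M0 Mc.
have eqc i : M i 0 * c 0 0 + M i 1 * c 1 0 = 0.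
  by have /matrixP/(_ i 0) := Mc; rewrite !mxE big_ord2.
have sol e0 e1 : c 0 0 = M 1 1 * e0 - M 0 1 * e1 ->
    c 1 0 = - M 1 0 * e0 + M 0 0 * e1 -> exists e, c = adj2 M *m e.
  move=> c0 c1; exists (mxlist 2 1 [:: [:: e0]; [:: e1]]).
  apply/matrixP => i j; rewrite ord1 !mxE big_ord2 !mxE /=.
  by case: (ord2_cases i) => -> /=; rewrite ?c0 ?c1 // mulNr.
have /eqP := eqc 0; have /eqP := eqc 1.
have [a0|a0] := eqVneq (M 0 0) 0; last first.
  rewrite addr_eq0 => _; rewrite addr_eq0 => /eqP e.
  apply: (sol 0 (c 1 0 / M 0 0)); last by field.
  by apply: (mulfI a0); rewrite e; field.
have [b0|b0] := eqVneq (M 0 1) 0; last first.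
  rewrite addr_eq0 => _; rewrite addr_eq0 => /eqP e.
  apply: (sol 0 (- c 0 0 / M 0 1)); first by field.
  by apply: (mulfI b0); rewrite -[LHS]opprK -e; field.
have [d0|d0] := eqVneq (M 1 1) 0; last first.
  rewrite addr_eq0 => /eqP e _.
  apply: (sol (c 0 0 / M 1 1) 0); first by field.
  by apply: (mulfI d0); rewrite -[LHS]opprK -e; field.
have [g0|g0] := eqVneq (M 1 0) 0; last first.
  rewrite addr_eq0 => /eqP e _.
  apply: (sol (- c 1 0 / M 1 0) 0); last by field.
  by apply: (mulfI g0); rewrite e; field.
case/eqP: M0; apply/matrixP => i j; rewrite mxE.
by case: (ord2_cases i) => ->; case: (ord2_cases j) => ->.
Qed.

Lemma adj2_mulE M c :
  (adj2 M *m c) 0 0 = M 1 1 * c 0 0 - M 0 1 * c 1 0 /\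
  (adj2 M *m c) 1 0 = M 0 0 * c 1 0 - M 1 0 * c 0 0.
Proof. by split; rewrite mxE big_ord2 !mxE /= mulNr // addrC. Qed.

End TwoByTwo.

Lemma adj2_mul_cvg (R : realType) (T : Type) (F : set_system T) {FF : Filter F}
    (C : T -> 'M[R[i]]_2) (C0 : 'M[R[i]]_2) (e : 'cV[R[i]]_2) :
  (forall i j, C t i j @[t --> F] --> C0 i j) ->
  forall i, (adj2 (C t) *m e) i 0 @[t --> F] --> (adj2 C0 *m e) i 0.
Proof.
move=> Cc i; have [e0 e1] := adj2_mulE C0 e.
have eC t := adj2_mulE (C t) e.
case: (ord2_cases i) => ->.
- rewrite e0; under eq_fun do rewrite (eC _).1.
  exact: cvgB (cvgM (Cc 1 1) (cvg_cst _)) (cvgM (Cc 0 1) (cvg_cst _)).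
- rewrite e1; under eq_fun do rewrite (eC _).2.
  exact: cvgB (cvgM (Cc 0 0) (cvg_cst _)) (cvgM (Cc 1 0) (cvg_cst _)).
Qed.


(** * The characteristic matrix of a boundary condition *)

Section Characteristic.
Variables (R : realType) (N : nat) (o : SLcoef R).
Implicit Types (M : 'M[R[i]]_(2, 2 + 2)) (mu : R[i]) (y : nat -> R[i]).

Definition boundary_values y : 'cV[R[i]]_(2 + 2) :=
  col_mx (mxlist 2 1 [:: [:: y 0%N]; [:: fDelta o y 0%N]])
         (mxlist 2 1 [:: [:: y N]; [:: fDelta o y N]]).

(** The matrix A + B Phi_N(mu), whose determinant is the value of [Gamma] at mu up
    to the choice of representative. *)
Definition char_matrix M mu : 'M[R[i]]_2 :=
  lsubmx M + rsubmx M *m map_mx (horner_eval mu) (PhiN N o).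

Lemma bc_holds_class M (rM : rank_two M) y :
  bc_holds N o (bcclass rM) y <-> M *m boundary_values y = 0.
Proof.
rewrite /bc_holds /bcA /bcB; have [T Tu ->] := bc_repr rM.
rewrite -mulmx_lsub -mulmx_rsub -!mulmxA -mulmxDr -mul_row_col hsubmxK.
split=> [e|->]; last by rewrite mulmx0.
by rewrite -[LHS](mulKmx Tu) e mulmx0.
Qed.

(** Hence the kernel of the characteristic matrix consists of the initial data of
    the solutions that satisfy the boundary condition. *)
Lemma char_matrix_boundary M mu (c : 'cV[R[i]]_2) (v : nat -> R[i]) :
  Omega N o -> v = (fun n => (SLsol o (c 0 0) (c 1 0) n).1.[mu]) ->
  M *m boundary_values v = char_matrix M mu *m c.
Proof.
move=> oO ->; rewrite /boundary_values.
have [_ v0 u0 /(_ N (leqnn N)) ->] := SLsol_equation (c 0 0) (c 1 0) mu oO.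
rewrite {}v0 {}u0 -{1}[M]hsubmxK mul_row_col /char_matrix mulmxDl -mulmxA.
have [-> ->] := SLsol_linear o (c 0 0) (c 1 0) N.
congr (_ + _); congr mulmx; apply/matrixP => i j.
  by rewrite ord1 !mxE; case: (ord2_cases i) => ->.
rewrite ord1 !mxE big_ord2 !mxE.
by case: (ord2_cases i) => -> /=; rewrite hornerD !hornerZ /horner_eval;
  congr (_ + _); rewrite mulrC.
Qed.

(** If the characteristic matrix vanished at mu, every entry of A + B Phi_N would
    be divisible by X - mu, and [Gamma] by its square. *)
Lemma simple_char_matrix M (rM : rank_two M) mu :
  mup mu (Gamma N o (bcclass rM)) = 1%N ->
  \det (char_matrix M mu) = 0 /\ char_matrix M mu != 0.
Proof.
rewrite /Gamma /bcA /bcB; have [T Tu ->] := bc_repr rM.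
rewrite -mulmx_lsub -mulmx_rsub; set P := _ + _ => mup1.
have PE : map_mx (horner_eval mu) P = T *m char_matrix M mu.
  have evalC (X : 'M[R[i]]_2) : map_mx (horner_eval mu) (map_mx polyC X) = X.
    by apply/matrixP => i j; rewrite !mxE /horner_eval hornerC.
  by rewrite map_mxD evalC [X in _ + X]map_mxM evalC mulmxDr mulmxA.
have detP0 : \det P != 0.
  apply/eqP => e; move: mup1; rewrite e /mup.
  by case: arg_maxnP; rewrite ?expr0 ?dvd1p // => -[k] /=; rewrite size_poly0; case: k.
split.
  have : root (\det P) mu by rewrite -dvdp_XsubCl XsubC_dvd // mup1.
  rewrite /root -[_.[_]]/(horner_eval mu (\det P)) -det_map_mx PE det_mulmx.
  rewrite mulf_eq0 => /orP[/eqP T0|/eqP//].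
  by move: Tu; rewrite unitmxE T0 unitr0.
apply/eqP => M0; move: PE; rewrite M0 mulmx0 => PE.
have Pdvd i j : P i j = ('X - mu%:P) * (P i j %/ ('X - mu%:P)).
  rewrite mulrC divpK // dvdp_XsubCl /root.
  by have /matrixP/(_ i j) := PE; rewrite !mxE => /eqP.
have : (2 <= mup mu (\det P))%N.
  rewrite mup_geq // (_ : P = ('X - mu%:P) *: (\matrix_(i, j) (P i j %/ ('X - mu%:P)))).
    by rewrite detZ dvdp_mulr.
  by apply/matrixP => i j; rewrite [LHS]Pdvd !mxE.
by rewrite mup1.
Qed.

End Characteristic.

(** * Continuity of the chart maps and of the branch *)

Section Continuity.
Variable R : realType.

Lemma continuous_mx (T : topologicalType) m n (f : T -> 'M[R[i]]_(m, n)) :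
  (forall i j, continuous (fun t => f t i j)) -> continuous f.
Proof.
move=> fc t A [P nP PA].
have tP := @filter_forall T 'I_m (fun i t' => forall j, P i j
      (f t' i j)) (nbhs t) (nbhs_filter t)
  (fun i => @filter_forall T 'I_n (fun j t' => P i j
      (f t' i j)) (nbhs t) (nbhs_filter t)
    (fun j => fc i j t _ (nP i j))).
by apply: filterS tP => t' ?; exact: PA.
Qed.

Lemma mk_sabc_continuous (T : topologicalType) (mx : T -> 'M[R[i]]_(2, 2 + 2))
    (rk : forall t, rank_two (mx t)) (sa : forall t, sa_matrix (mx t)) :
  (forall i j, continuous (fun t => mx t i j)) ->
  continuous (fun t => mk_sabc (rk t) (sa t)).
Proof.
move=> mxc; apply: (@continuous_comp_initial _ _ _ set_val).
pose e t : bc_matrix R := exist _ (mx t) (mem_set (rk t)).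
have ec : continuous e.
  by apply: (@continuous_comp_initial _ _ _ set_val); exact: continuous_mx.
move=> t; apply: (@continuous_comp _ _ _ e \pi_(bcspace R)%qT t); first exact: ec.
exact: pi_continuous.
Qed.

Lemma within_nbhs_continuous (S T : topologicalType) (U : set S) (f : S -> T) x :
  nbhs x U -> {within U, continuous f} -> {for x, continuous f}.
Proof.
by move=> xU /(_ x); rewrite /continuous_at /prop_for -nbhs_subspace_interior.
Qed.

End Continuity.

(** * A continuous family of eigenfunctions *)

Section EigenfunctionFamily.
Variables (R : realType) (N : nat) (o : SLcoef R).
Variables (mx : chart_param R -> 'M[R[i]]_(2, 2 + 2)).
Hypothesis oO : Omega N o.
Hypothesis mxc : forall i j, continuous (fun p => mx p i j).

Lemma char_matrix_cvg p (mu : chart_param R -> R[i]) lam i j :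
  mu h @[h --> 0] --> lam ->
  char_matrix N o (mx (h + p)) (mu h) i j @[h --> 0] -->
  char_matrix N o (mx p) lam i j.
Proof.
move=> mulam.
have mxp a b : mx (h + p) a b @[h --> 0] --> mx p a b.
  apply: (cvg_comp (fun h => h + p) (fun q => mx q a b) (@cvg_translate R p)).
  exact: mxc.
have CE M z : char_matrix N o M z i j = M i (lshift 2 j) +
    (M i (rshift 2 0) * (PhiN N o 0 j).[z] + M i (rshift 2 1) * (PhiN N o 1 j).[z]).
  by rewrite !mxE big_ord2 !mxE.
rewrite CE; under eq_fun do rewrite CE.
by apply: cvgD; [|apply: cvgD; apply: cvgM; [|exact: cvg_horner| |exact: cvg_horner]];
  exact: mxp.
Qed.

(** The initial data of v h are the adjugate of the characteristic matrix at h
    applied to a fixed vector: they lie in its kernel because the determinant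
    vanishes, and depend continuously on the matrix. *)
Lemma eigenfunction_family p (mu : chart_param R -> R[i]) lam y :
  mu h @[h --> 0] --> lam ->
  (\forall h \near 0, \det (char_matrix N o (mx (h + p)) (mu h)) = 0) ->
  char_matrix N o (mx p) lam != 0 ->
  SLequation N o lam y -> mx p *m boundary_values N o y = 0 ->
  exists v : chart_param R -> nat -> R[i],
    [/\ forall h, SLequation N o (mu h) (v h),
        \forall h \near 0, mx (h + p) *m boundary_values N o (v h) = 0,
        forall n, (n <= N)%N -> v h n @[h --> 0] --> y n &
        forall n, (n <= N)%N -> fDelta o (v h) n @[h --> 0] --> fDelta o y n].
Proof.
move=> mulam det0 C0 ySL ybc.
pose C h := char_matrix N o (mx (h + p)) (mu h).
pose y0 := mxlist 2 1 [:: [:: y 0%N]; [:: fDelta o y 0%N]].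
have y00 : y0 0 0 = y 0%N by rewrite mxE.
have y01 : y0 1 0 = fDelta o y 0%N by rewrite mxE.
have Cy0 : char_matrix N o (mx p) lam *m y0 = 0.
  rewrite -(char_matrix_boundary _ oO (erefl _)) -[RHS]ybc y00 y01; congr mulmx.
  have [_ e0 e1 eN] := SLsol_equation (y 0%N) (fDelta o y 0%N) lam oO.
  rewrite /boundary_values e0 e1 (eN _ (leqnn N)).
  by have [<- <-] := SLsol_unique oO ySL (leqnn N).
have [e y0E] := kernel_adj2 C0 Cy0.
pose c h := adj2 (C h) *m e.
have cc i : c h i 0 @[h --> 0] --> y0 i 0.
  rewrite y0E; apply: adj2_mul_cvg => i' j'; exact: char_matrix_cvg.
exists (fun h n => (SLsol o (c h 0 0) (c h 1 0) n).1.[mu h]).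
have cp n : c h 0 0 * (SLsol o 1 0 n).1.[mu h] + c h 1 0 * (SLsol o 0 1 n).1.[mu h]
     @[h --> 0] --> y0 0 0 * (SLsol o 1 0 n).1.[lam] + y0 1 0 * (SLsol o 0 1 n).1.[lam].
  by apply: cvgD; apply: cvgM; [exact: cc|exact: cvg_horner|exact: cc|exact: cvg_horner].
have cq n : c h 0 0 * (SLsol o 1 0 n).2.[mu h] + c h 1 0 * (SLsol o 0 1 n).2.[mu h]
     @[h --> 0] --> y0 0 0 * (SLsol o 1 0 n).2.[lam] + y0 1 0 * (SLsol o 0 1 n).2.[lam].
  by apply: cvgD; apply: cvgM; [exact: cc|exact: cvg_horner|exact: cc|exact: cvg_horner].
split.
- by move=> h; have [] := SLsol_equation (c h 0 0) (c h 1 0) (mu h) oO.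
- apply: filterS det0 => h deth.
  rewrite (char_matrix_boundary _ oO (erefl _)) mulmxA mul_adj2 deth.
  by rewrite -scalemx1 scale0r mul0mx.
- move=> n nN; have [-> _] := SLsol_unique oO ySL nN.
  have [-> _] := SLsol_linear o (y 0%N) (fDelta o y 0%N) n.
  rewrite hornerD !hornerZ -y00 -y01.
  under eq_fun => h.
    have [-> _] := SLsol_linear o (c h 0 0) (c h 1 0) n.
    rewrite hornerD !hornerZ; over.
  exact: cp.
- move=> n nN; have [_ ->] := SLsol_unique oO ySL nN.
  have [_ ->] := SLsol_linear o (y 0%N) (fDelta o y 0%N) n.
  rewrite hornerD !hornerZ -y00 -y01.
  under eq_fun => h.
    have [_ _ _ ->//] := SLsol_equation (c h 0 0) (c h 1 0) (mu h) oO.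
    have [_ ->] := SLsol_linear o (c h 0 0) (c h 1 0) n.
    rewrite hornerD !hornerZ; over.
  exact: cq.
Qed.

End EigenfunctionFamily.

(** * The derivative of the branch in a chart *)

Definition i4_0 : 'I_(2 + 2) := @Ordinal 4 0 isT.
Definition i4_1 : 'I_(2 + 2) := @Ordinal 4 1 isT.
Definition i4_2 : 'I_(2 + 2) := @Ordinal 4 2 isT.
Definition i4_3 : 'I_(2 + 2) := @Ordinal 4 3 isT.

Lemma i4_cases (k : 'I_(2 + 2)) : [\/ k = i4_0, k = i4_1, k = i4_2 | k = i4_3].
Proof.
by case: k => -[|[|[|[|//]]]] ?; [apply: Or41|apply: Or42|apply: Or43|apply: Or44];
  exact: val_inj.
Qed.

Section ChartDerivative.
Variables (R : realType) (N : nat) (o : SLcoef R).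
Implicit Types (Y V : 'cV[R[i]]_(2 + 2)) (h p : chart_param R).

Lemma boundary_valuesE (y : nat -> R[i]) :
  [/\ boundary_values N o y i4_0 0 = y 0%N,
      boundary_values N o y i4_1 0 = fDelta o y 0%N,
      boundary_values N o y i4_2 0 = y N &
      boundary_values N o y i4_3 0 = fDelta o y N].
Proof.
have -> : i4_0 = lshift 2 (0 : 'I_2) by exact: val_inj.
have -> : i4_1 = lshift 2 (1 : 'I_2) by exact: val_inj.
have -> : i4_2 = rshift 2 (0 : 'I_2) by exact: val_inj.
have -> : i4_3 = rshift 2 (1 : 'I_2) by exact: val_inj.
by split; rewrite /boundary_values ?col_mxEu ?col_mxEd mxE.
Qed.

(** The bracket W_N - W_0 of [lagrange_identity] in terms of boundary values. *)
Definition boundary_form Y V : R[i] :=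
  (Num.conj (Y i4_3 0) * V i4_2 0 - V i4_3 0 * Num.conj (Y i4_2 0)) -
  (Num.conj (Y i4_1 0) * V i4_0 0 - V i4_1 0 * Num.conj (Y i4_0 0)).

(** Each chart singles out two boundary values k1 and k2; on these the form of the
    theorem has the Hermitian matrix with rows (s, conj z) and (z, t). *)
Definition variation_form (k1 k2 : 'I_(2 + 2)) h Y V : R[i] :=
  Num.conj (Y k1 0) * (cs h * V k1 0 + Num.conj (cz h) * V k2 0) +
  Num.conj (Y k2 0) * (cz h * V k1 0 + ct h * V k2 0).

(** The form is real-linear in the four coordinates of h.  For z = x + i y the
    coefficient of y comes from i and its conjugate - i, hence the difference
    multiplied by i in the last slope. *)
Lemma re_div_variation_form k1 k2 h Y V (D : R[i]) :
  complex.Re (variation_form k1 k2 h Y V / D) =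
  chart_linear (complex.Re (Num.conj (Y k1 0) * V k1 0 / D))
    (complex.Re (Num.conj (Y k2 0) * V k2 0 / D))
    (complex.Re ((Num.conj (Y k1 0) * V k2 0 + Num.conj (Y k2 0) * V k1 0) / D))
    (complex.Re ('i * (Num.conj (Y k2 0) * V k1 0 - Num.conj (Y k1 0) * V k2 0) / D))
    h.
Proof.
have czE : Num.conj (cz h) = h.2.1 -i* h.2.2 by [].
rewrite /variation_form /chart_linear czE /cs /ct /cz.
move: (Num.conj (Y k1 0)) (Num.conj (Y k2 0)) (V k1 0) (V k2 0) D^-1.
move=> [a a'] [b b'] [c c'] [d d'] [e e'].
case: h {czE} => [[s t] [x z]] /=.
simpc; rewrite /=; ring.
Qed.

Lemma variation_form_real k1 k2 h Y :
  (complex.Re (variation_form k1 k2 h Y Y))%:C = variation_form k1 k2 h Y Y.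
Proof.
have cE (z : R[i]) : Num.conj z = complex.Re z -i* complex.Im z by case: z.
rewrite /variation_form !cE /cs /ct /cz.
case: (Y k1 0) (Y k2 0) h => [a a'] [b b'] [[s t] [x z]] /=.
simpc; apply/eqP; rewrite eq_complex /= eqxx /=; apply/eqP; ring.
Qed.

Variables (mx : chart_param R -> 'M[R[i]]_(2, 2 + 2)).
Variables (rk : forall p, rank_two (mx p)) (sa : forall p, sa_matrix (mx p)).
Let pt p := mk_sabc (rk p) (sa p).
Variables k1 k2 : 'I_(2 + 2).
Hypothesis mxc : forall i j, continuous (fun p => mx p i j).
Hypothesis greenE : forall p h Y V, mx p *m Y = 0 -> mx (h + p) *m V = 0 ->
  boundary_form Y V = variation_form k1 k2 h Y V.

(** [lagrange_identity] applied to y and to the family of [eigenfunction_family]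
    gives the increment of the branch as [variation_form] divided by a sum D that
    tends to the squared norm of y. *)
Lemma chart_derivative p lam y U (Lambda : sabc R -> R) :
  Omega N o -> simple_eigenvalue N o (val (pt p)) lam%:C ->
  eigenfunction N o (val (pt p)) lam%:C y -> normalized N o y ->
  simple_branch N o (pt p) lam U Lambda ->
  differentiable (Lambda \o pt) p /\
  forall h, ('d (Lambda \o pt) p h)%:C =
    variation_form k1 k2 h (boundary_values N o y) (boundary_values N o y).
Proof.
move=> oO [_ mup1] [_ ySL /bc_holds_class ybc] ynorm [nU _ Lc Llam Lsimple].
have [_ C0] := simple_char_matrix mup1.
have ptc : pt (h + p) @[h --> (0 : chart_param R)] --> pt p.
  apply: (cvg_comp (fun h => h + p) pt (@cvg_translate R p)).
  exact: (@mk_sabc_continuous _ _ mx rk sa mxc p).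
pose m h := Lambda (pt (h + p)).
have mc : m h @[h --> 0] --> lam.
  rewrite -Llam; exact: (cvg_comp _ _ ptc (within_nbhs_continuous nU Lc)).
have muc : (m h)%:C @[h --> 0] --> lam%:C by exact: cvg_real_complex.
have det0 : \forall h \near 0, \det (char_matrix N o (mx (h + p)) (m h)%:C) = 0.
  have nU0 : \forall h \near (0 : chart_param R), U (pt (h + p)) by exact: ptc.
  by apply: filterS nU0 => h /Lsimple [_ /simple_char_matrix []].
have [v [vSL vbc vc dvc]] := eigenfunction_family oO mxc muc det0 C0 ySL ybc.
pose Y := boundary_values N o y; pose V h := boundary_values N o (v h).
pose D h := \sum_(1 <= n < N.+1) (SLw o n)%:C * v h n * Num.conj (y n).
have Dc : D h @[h --> 0] --> (1 : R[i]).
  have -> : (1 : R[i]) = \sum_(1 <= n < N.+1) (SLw o n)%:C * y n * Num.conj (y n).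
    by rewrite -ynorm; apply: eq_bigr => n _; rewrite normCK mulrA.
  rewrite big_add1 /= big_mkord /D.
  under eq_fun do rewrite big_add1 /= big_mkord.
  apply: cvg_big => [|i _]; first exact: add_continuous.
  exact: cvgM (cvgM (cvg_cst _) (vc _ (ltn_ord i))) (cvg_cst _).
have Vc k : V h k 0 @[h --> 0] --> Y k 0.
  rewrite /Y /V.
  have [e0 e1 e2 e3] := boundary_valuesE y.
  have [E0 E1] : (forall h, boundary_values N o (v h) i4_0 0 = v h 0%N) /\
      (forall h, boundary_values N o (v h) i4_1 0 = fDelta o (v h) 0%N).
    by split=> h; have [] := boundary_valuesE (v h).
  have [E2 E3] : (forall h, boundary_values N o (v h) i4_2 0 = v h N) /\
      (forall h, boundary_values N o (v h) i4_3 0 = fDelta o (v h) N).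
    by split=> h; have [] := boundary_valuesE (v h).
  case: (i4_cases k) => ->.
  - by rewrite e0; under eq_fun do rewrite E0; exact: vc.
  - rewrite e1; under eq_fun do rewrite E1; exact: dvc.
  - rewrite e2; under eq_fun do rewrite E2; exact: vc.
  - rewrite e3; under eq_fun do rewrite E3; exact: dvc.
have D0 : \forall h \near (0 : chart_param R), D h != 0.
  exact: (cvgr_neq0 (1 : R[i]) Dc (oner_neq0 _)).
have slope : \forall h \near 0, (m h)%:C - lam%:C = variation_form k1 k2 h Y (V h) / D h.
  apply: filterS2 vbc D0 => h vbch Dh0.
  apply: (canRL (mulfK Dh0)).
  rewrite /D (lagrange_identity (conjc_real lam : Num.conj lam%:C = lam%:C) ySL (vSL h)).
  rewrite -(greenE ybc vbch) /boundary_form.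
  have [-> -> -> ->] := boundary_valuesE y.
  by have [-> -> -> ->] := boundary_valuesE (v h).
pose g1 h := complex.Re (Num.conj (Y k1 0) * V h k1 0 / D h).
pose g2 h := complex.Re (Num.conj (Y k2 0) * V h k2 0 / D h).
pose g3 h := complex.Re
  ((Num.conj (Y k1 0) * V h k2 0 + Num.conj (Y k2 0) * V h k1 0) / D h).
pose g4 h := complex.Re
  ('i * (Num.conj (Y k2 0) * V h k1 0 - Num.conj (Y k1 0) * V h k2 0) / D h).
have Di : (D h)^-1 @[h --> 0] --> (1^-1 : R[i]) by exact: cvgV (oner_neq0 _) Dc.
have c1 : g1 h @[h --> 0] --> complex.Re (Num.conj (Y k1 0) * Y k1 0 / 1).
  exact: cvg_Re (cvgM (cvgM (cvg_cst _) (Vc _)) Di).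
have c2 : g2 h @[h --> 0] --> complex.Re (Num.conj (Y k2 0) * Y k2 0 / 1).
  exact: cvg_Re (cvgM (cvgM (cvg_cst _) (Vc _)) Di).
have c3 : g3 h @[h --> 0] -->
    complex.Re ((Num.conj (Y k1 0) * Y k2 0 + Num.conj (Y k2 0) * Y k1 0) / 1).
  exact: cvg_Re (cvgM (cvgD (cvgM (cvg_cst _) (Vc _)) (cvgM (cvg_cst _) (Vc _))) Di).
have c4 : g4 h @[h --> 0] -->
    complex.Re ('i * (Num.conj (Y k2 0) * Y k1 0 - Num.conj (Y k1 0) * Y k2 0) / 1).
  exact: cvg_Re (cvgM (cvgM (cvg_cst _)
    (cvgB (cvgM (cvg_cst _) (Vc _)) (cvgM (cvg_cst _) (Vc _)))) Di).
have [|dif difE] := @slope_differentiable _ (Lambda \o pt) p _ _ _ _ _ _ _ _ c1 c2 c3 c4.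
  apply: filterS slope => h /(congr1 (@complex.Re R)).
  by rewrite re_div_variation_form -rmorphB /= Llam.
split=> // h; rewrite difE -re_div_variation_form divr1.
exact: variation_form_real.
Qed.

End ChartDerivative.

(** * Tangent vectors of an affine chart *)

Section AffineCharts.
Variable R : realType.
Implicit Types (h p : chart_param R) (Y V : 'cV[R[i]]_(2 + 2)).

Lemma derive_affine (f : chart_param R -> R) p h c :
  (forall t, f (t *: h + p) - f p = t * c) -> 'D_h f p = c.
Proof.
move=> fE; rewrite /derive; apply/cvg_lim; first exact: Rhausdorff.
apply: cvg_near_cst; near=> t.
have t0 : t != 0 by near: t; exact: nbhs_dnbhs_neq.
by rewrite /= /shift /= fE -[LHS]/(t^-1 * (t * c)) mulKf.
Unshelve. all: by end_near. Qed.

Variables (mx : chart_param R -> 'M[R[i]]_(2, 2 + 2)).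
Variable HL : R -> R -> R[i] -> 'M[R[i]]_(2, 2 + 2).
Hypothesis HL_affine : forall p h, mx (h + p) = mx p + HL h.1.1 h.1.2 (cz h).
Hypothesis HL_scale : forall (t s s' : R) (z : R[i]),
  HL (t * s) (t * s') (t%:C * z) = t%:C *: HL s s' z.
Hypothesis HL_inj : forall s t z s' t' z',
  HL s t z = HL s' t' z' -> [/\ s = s', t = t' & z = z'].

Lemma chart_variationE p h : chart_variation mx p h = HL h.1.1 h.1.2 (cz h).
Proof.
have HLt t : HL (t *: h).1.1 (t *: h).1.2 (cz (t *: h)) = t%:C *: HL h.1.1 h.1.2 (cz h).
  by rewrite -HL_scale /cz; congr HL; simpc.
apply/matrixP => i j; rewrite !mxE.
set e := HL _ _ _ i j.
have D t : mx (t *: h + p) i j = mx p i j + t%:C * e by rewrite HL_affine HLt !mxE.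
rewrite (@derive_affine _ p h (complex.Re e)); last first.
  by move=> t; rewrite D raddfD /= addrAC subrr add0r; case: e {D} => a b /=; ring.
rewrite (@derive_affine _ p h (complex.Im e)); last first.
  by move=> t; rewrite D raddfD /= addrAC subrr add0r; case: e {D} => a b /=; ring.
by case: e {D}.
Qed.

Lemma tangent_spaceE p :
  tangent_space mx p = [set X | exists s t z, X = HL s t z].
Proof.
apply/seteqP; split=> [_ [h _ <-]|_ [s [t [z ->]]]] /=.
  by exists h.1.1, h.1.2, (cz h); rewrite chart_variationE.
by exists ((s, t), (complex.Re z, complex.Im z)) => //;
  rewrite chart_variationE /cz /=; case: z.
Qed.

(** Injectivity of HL makes the coordinates of a tangent vector unique, which
    determines the value of [xget] in [dchart]. *)
Lemma dchartE (pt : chart_param R -> sabc R) (Lambda : sabc R -> R) p s t z :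
  dchart mx pt Lambda p (HL s t z) =
  'd (Lambda \o pt) p ((s, t), (complex.Re z, complex.Im z)).
Proof.
rewrite /dchart; congr ('d _ _ _).
apply: xget_unique; first by rewrite /= chart_variationE /cz /=; case: z.
move=> [[s' t'] [x y]]; rewrite /= chart_variationE /cz /= => /HL_inj [-> ->] <-.
by [].
Qed.

End AffineCharts.

(** * The four charts *)

Section StandardCharts.
Variable R : realType.
Implicit Types (h p : chart_param R) (Y V : 'cV[R[i]]_(2 + 2)).

Lemma cs_continuous : continuous (@cs R).
Proof. by move=> p; apply: cvg_real_complex; have [] := cvg_chart_coords p. Qed.

Lemma ct_continuous : continuous (@ct R).
Proof. by move=> p; apply: cvg_real_complex; have [] := cvg_chart_coords p. Qed.

Lemma cz_continuous : continuous (@cz R).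
Proof.
move=> p; have [_ _ px py] := cvg_chart_coords p.
have -> : @cz R = (fun q => q.2.1%:C + 'i * q.2.2%:C).
  by apply/funext => q; rewrite /cz; simpc.
exact: cvgD (cvg_real_complex px) (cvgM (cvg_cst _) (cvg_real_complex py)).
Qed.

Lemma conj_cz_continuous : continuous (fun p : chart_param R => Num.conj (cz p)).
Proof. by move=> p; apply: cvg_conj; exact: cz_continuous. Qed.

Lemma csD h p : cs (h + p) = cs h + cs p.
Proof. by rewrite /cs -rmorphD. Qed.
Lemma ctD h p : ct (h + p) = ct h + ct p.
Proof. by rewrite /ct -rmorphD. Qed.
Lemma czD h p : cz (h + p) = cz h + cz p.
Proof. by rewrite /cz; simpc. Qed.

Lemma mul_boundary (M : 'M[R[i]]_(2, 2 + 2)) Y i : M *m Y = 0 ->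
  M i i4_0 * Y i4_0 0 + M i i4_1 * Y i4_1 0 + M i i4_2 * Y i4_2 0 + M i i4_3 * Y i4_3 0 = 0.
Proof.
move=> MY; have <- : (M *m Y) i 0 = 0 by rewrite MY mxE.
rewrite mxE 3!big_ord_recl big_ord1 !addrA.
by congr (M i _ * Y _ 0 + M i _ * Y _ 0 + M i _ * Y _ 0 + M i _ * Y _ 0); exact: val_inj.
Qed.

Local Ltac entry_continuity :=
  move=> [[|[|//]] ?] [[|[|[|[|//]]]] ?]; under eq_fun do rewrite mxE /=;
  lazymatch goal with
  | |- context [Num.conj _] => exact: conj_cz_continuous
  | |- context [cz _] => exact: cz_continuous
  | |- context [cs _] => exact: cs_continuous
  | |- context [ct _] => exact: ct_continuous
  | |- _ => exact: cst_continuous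
  end.

Lemma mx13_continuous i j : continuous (fun p : chart_param R => mx13 p i j).
Proof. by move: i j; entry_continuity. Qed.
Lemma mx14_continuous i j : continuous (fun p : chart_param R => mx14 p i j).
Proof. by move: i j; entry_continuity. Qed.
Lemma mx23_continuous i j : continuous (fun p : chart_param R => mx23 p i j).
Proof. by move: i j; entry_continuity. Qed.
Lemma mx24_continuous i j : continuous (fun p : chart_param R => mx24 p i j).
Proof. by move: i j; entry_continuity. Qed.

Local Ltac conj_ring :=
  rewrite ?csD ?ctD ?czD ?(rmorphD, rmorphN, rmorphM) /= ?conjCK ?csK ?ctK; ring.

Lemma eq_of_subr (x y e : R[i]) : e = 0 -> x - y = e \/ x - y = - e -> x = y.
Proof. by move=> -> xy; apply/eqP; rewrite -subr_eq0; case: xy => ->; rewrite ?oppr0. Qed.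

(** Once the two boundary conditions are solved for the boundary values outside
    the chart and substituted in W_N - W_0, the coordinates of p cancel because
    the coefficient matrix is Hermitian up to signs. *)
Lemma mx13_boundary_form p h Y V : mx13 p *m Y = 0 -> mx13 (h + p) *m V = 0 ->
  boundary_form Y V = variation_form i4_1 i4_3 h Y V.
Proof.
have solve (q : chart_param R) (X : 'cV[R[i]]_(2 + 2)) : mx13 q *m X = 0 ->
    X i4_0 0 = - (cs q * X i4_1 0 + Num.conj (cz q) * X i4_3 0) /\
    X i4_2 0 = cz q * X i4_1 0 + ct q * X i4_3 0.
  move=> bX; have := mul_boundary 0 bX; have := mul_boundary 1 bX.
  rewrite !mxE /= => e1 e0.
  by split; [apply: (eq_of_subr e0); left|apply: (eq_of_subr e1); right]; ring.
move=> /solve[Y1 Y2] /solve[V1 V2].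
rewrite /boundary_form /variation_form Y1 Y2 V1 V2; conj_ring.
Qed.

Lemma mx14_boundary_form p h Y V : mx14 p *m Y = 0 -> mx14 (h + p) *m V = 0 ->
  boundary_form Y V = variation_form i4_1 i4_2 h Y V.
Proof.
have solve (q : chart_param R) (X : 'cV[R[i]]_(2 + 2)) : mx14 q *m X = 0 ->
    X i4_0 0 = - (cs q * X i4_1 0 + Num.conj (cz q) * X i4_2 0) /\
    X i4_3 0 = - (cz q * X i4_1 0 + ct q * X i4_2 0).
  move=> bX; have := mul_boundary 0 bX; have := mul_boundary 1 bX.
  rewrite !mxE /= => e1 e0.
  by split; [apply: (eq_of_subr e0); left|apply: (eq_of_subr e1); left]; ring.
move=> /solve[Y1 Y2] /solve[V1 V2].
rewrite /boundary_form /variation_form Y1 Y2 V1 V2; conj_ring.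
Qed.

Lemma mx23_boundary_form p h Y V : mx23 p *m Y = 0 -> mx23 (h + p) *m V = 0 ->
  boundary_form Y V = variation_form i4_0 i4_3 h Y V.
Proof.
have solve (q : chart_param R) (X : 'cV[R[i]]_(2 + 2)) : mx23 q *m X = 0 ->
    X i4_1 0 = cs q * X i4_0 0 + Num.conj (cz q) * X i4_3 0 /\
    X i4_2 0 = cz q * X i4_0 0 + ct q * X i4_3 0.
  move=> bX; have := mul_boundary 0 bX; have := mul_boundary 1 bX.
  rewrite !mxE /= => e1 e0.
  by split; [apply: (eq_of_subr e0); right|apply: (eq_of_subr e1); right]; ring.
move=> /solve[Y1 Y2] /solve[V1 V2].
rewrite /boundary_form /variation_form Y1 Y2 V1 V2; conj_ring.
Qed.

Lemma mx24_boundary_form p h Y V : mx24 p *m Y = 0 -> mx24 (h + p) *m V = 0 ->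
  boundary_form Y V = variation_form i4_0 i4_2 h Y V.
Proof.
have solve (q : chart_param R) (X : 'cV[R[i]]_(2 + 2)) : mx24 q *m X = 0 ->
    X i4_1 0 = cs q * X i4_0 0 + Num.conj (cz q) * X i4_2 0 /\
    X i4_3 0 = - (cz q * X i4_0 0 + ct q * X i4_2 0).
  move=> bX; have := mul_boundary 0 bX; have := mul_boundary 1 bX.
  rewrite !mxE /= => e1 e0.
  by split; [apply: (eq_of_subr e0); right|apply: (eq_of_subr e1); left]; ring.
move=> /solve[Y1 Y2] /solve[V1 V2].
rewrite /boundary_form /variation_form Y1 Y2 V1 V2; conj_ring.
Qed.

End StandardCharts.

(** * The derivative formulas *)

Section ChartFormula.
Variables (R : realType) (N : nat) (o : SLcoef R).
Variables (mx : chart_param R -> 'M[R[i]]_(2, 2 + 2)).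
Variables (rk : forall p, rank_two (mx p)) (sa : forall p, sa_matrix (mx p)).
Variable HL : R -> R -> R[i] -> 'M[R[i]]_(2, 2 + 2).
Variables k1 k2 : 'I_(2 + 2).
Hypothesis mxc : forall i j, continuous (fun p => mx p i j).
Hypothesis greenE : forall p h Y V, mx p *m Y = 0 -> mx (h + p) *m V = 0 ->
  boundary_form Y V = variation_form k1 k2 h Y V.
Hypothesis HL_affine : forall p h, mx (h + p) = mx p + HL h.1.1 h.1.2 (cz h).
Hypothesis HL_scale : forall (t s s' : R) (z : R[i]),
  HL (t * s) (t * s') (t%:C * z) = t%:C *: HL s s' z.
Hypothesis HL_inj : forall s t z s' t' z',
  HL s t z = HL s' t' z' -> [/\ s = s', t = t' & z = z'].

Lemma chart_formula p lam y U (Lambda : sabc R -> R) :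
  let pt q := mk_sabc (rk q) (sa q) in
  let b := boundary_values N o in
  let ybar n := Num.conj (y n) in
  Omega N o -> simple_eigenvalue N o (val (pt p)) lam%:C ->
  eigenfunction N o (val (pt p)) lam%:C y -> normalized N o y ->
  simple_branch N o (pt p) lam U Lambda ->
  [/\ tangent_space mx p = [set X | exists s t z, X = HL s t z],
      differentiable (Lambda \o pt) p &
      forall s t z, (dchart mx pt Lambda p (HL s t z))%:C%:M =
        mxlist 1 2 [:: [:: b ybar k1 0; b ybar k2 0]]
        *m mxlist 2 2 [:: [:: s%:C; Num.conj z]; [:: z; t%:C]]
        *m mxlist 2 1 [:: [:: b y k1 0]; [:: b y k2 0]]].
Proof.
move=> pt b ybar oO sl ey ny sb.
have [dif difE] := chart_derivative mxc greenE oO sl ey ny sb.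
split; [exact: tangent_spaceE|exact: dif|] => s t z.
rewrite (dchartE HL_affine HL_scale HL_inj) difE /variation_form /cs /ct /=.
have bC k : b ybar k 0 = Num.conj (b y k 0).
  have fC n : fDelta o ybar n = Num.conj (fDelta o y n).
    by rewrite /fDelta rmorphM rmorphB /=; congr (_ * _); exact/esym/conjc_real.
  rewrite /b; have [e0 e1 e2 e3] := boundary_valuesE N o y.
  have [f0 f1 f2 f3] := boundary_valuesE N o ybar.
  by case: (i4_cases k) => ->; rewrite ?e0 ?e1 ?e2 ?e3 ?f0 ?f1 ?f2 ?f3 ?fC.
rewrite (_ : cz _ = z); last by case: z.
rewrite !bC -/b; move: (b y k1 0) (b y k2 0) => u1 u2.
apply/matrixP => i j; rewrite !ord1 !(mxE, big_ord_recl, big_ord0) /= mulr1n.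
ring.
Qed.

End ChartFormula.

Local Ltac matrix_entries :=
  apply/matrixP => -[[|[|//]] ?] [[|[|[|[|//]]]] ?]; rewrite !mxE /=.

Theorem theorem4p5 (R : realType) (N : nat) (omega : SLcoef R) (A : sabc R)
    (lam : R) (y : nat -> R[i]) (U : set (sabc R)) (Lambda : sabc R -> R) :
  (2 <= N)%N ->
  Omega N omega ->
  simple_eigenvalue N omega (val A) lam%:C ->
  eigenfunction N omega (val A) lam%:C y ->
  normalized N omega y ->
  simple_branch N omega A lam U Lambda ->
  let ybar : nat -> R[i] := fun n => Num.conj (y n) in
  (forall p : chart_param R, A = pt13 p ->
    let HL (h12 l22 : R) (h22 : R[i]) : 'M[R[i]]_(2, 2 + 2) :=
      mxlist 2 (2 + 2) [:: [:: 0; h12%:C; 0; Num.conj h22]; [:: 0; h22; 0; l22%:C]] in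
    [/\ tangent_space mx13 p =
          [set X | exists (h12 l22 : R) (h22 : R[i]), X = HL h12 l22 h22],
        differentiable (Lambda \o pt13) p &
        forall (h12 l22 : R) (h22 : R[i]),
          (dchart mx13 pt13 Lambda p (HL h12 l22 h22))%:C%:M =
          mxlist 1 2 [:: [:: fDelta omega ybar 0%N; fDelta omega ybar N]]
          *m mxlist 2 2 [:: [:: h12%:C; Num.conj h22]; [:: h22; l22%:C]]
          *m mxlist 2 1 [:: [:: fDelta omega y 0%N]; [:: fDelta omega y N]]]) /\
  (forall p : chart_param R, A = pt14 p ->
    let HL (h12 l21 : R) (h22 : R[i]) : 'M[R[i]]_(2, 2 + 2) :=
      mxlist 2 (2 + 2) [:: [:: 0; h12%:C; Num.conj h22; 0]; [:: 0; h22; l21%:C; 0]] in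
    [/\ tangent_space mx14 p =
          [set X | exists (h12 l21 : R) (h22 : R[i]), X = HL h12 l21 h22],
        differentiable (Lambda \o pt14) p &
        forall (h12 l21 : R) (h22 : R[i]),
          (dchart mx14 pt14 Lambda p (HL h12 l21 h22))%:C%:M =
          mxlist 1 2 [:: [:: fDelta omega ybar 0%N; ybar N]]
          *m mxlist 2 2 [:: [:: h12%:C; Num.conj h22]; [:: h22; l21%:C]]
          *m mxlist 2 1 [:: [:: fDelta omega y 0%N]; [:: y N]]]) /\
  (forall p : chart_param R, A = pt23 p ->
    let HL (h11 l22 : R) (h21 : R[i]) : 'M[R[i]]_(2, 2 + 2) :=
      mxlist 2 (2 + 2) [:: [:: h11%:C; 0; 0; Num.conj h21]; [:: h21; 0; 0; l22%:C]] in
    [/\ tangent_space mx23 p =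
          [set X | exists (h11 l22 : R) (h21 : R[i]), X = HL h11 l22 h21],
        differentiable (Lambda \o pt23) p &
        forall (h11 l22 : R) (h21 : R[i]),
          (dchart mx23 pt23 Lambda p (HL h11 l22 h21))%:C%:M =
          mxlist 1 2 [:: [:: ybar 0%N; fDelta omega ybar N]]
          *m mxlist 2 2 [:: [:: h11%:C; Num.conj h21]; [:: h21; l22%:C]]
          *m mxlist 2 1 [:: [:: y 0%N]; [:: fDelta omega y N]]]) /\
  (forall p : chart_param R, A = pt24 p ->
    let HL (h11 l21 : R) (h21 : R[i]) : 'M[R[i]]_(2, 2 + 2) :=
      mxlist 2 (2 + 2) [:: [:: h11%:C; 0; Num.conj h21; 0]; [:: h21; 0; l21%:C; 0]] in
    [/\ tangent_space mx24 p =
          [set X | exists (h11 l21 : R) (h21 : R[i]), X = HL h11 l21 h21],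
        differentiable (Lambda \o pt24) p &
        forall (h11 l21 : R) (h21 : R[i]),
          (dchart mx24 pt24 Lambda p (HL h11 l21 h21))%:C%:M =
          mxlist 1 2 [:: [:: ybar 0%N; ybar N]]
          *m mxlist 2 2 [:: [:: h11%:C; Num.conj h21]; [:: h21; l21%:C]]
          *m mxlist 2 1 [:: [:: y 0%N]; [:: y N]]]).

Proof.
move=> _ oO sl ey ny sb ybar.
have [Y0 Y1 Y2 Y3] := boundary_valuesE N omega y.
have [Yb0 Yb1 Yb2 Yb3] := boundary_valuesE N omega ybar.
split; [|split; [|split]] => p Ap HL; rewrite {}Ap in sl ey sb.
- have := @chart_formula _ N omega mx13 (@mx13_rank2 R) (@mx13_sa R) HL i4_1 i4_3
    (@mx13_continuous R) (@mx13_boundary_form R) _ _ _ p lam y U Lambda oO sl ey ny sb.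
  rewrite -/ybar Y1 Y3 Yb1 Yb3; apply.
  + move=> q h; matrix_entries;
      rewrite ?csD ?ctD ?czD ?rmorphD ?addr0 //= addrC //.
  + move=> r s t z; matrix_entries; rewrite ?mulr0 ?rmorphM //=.
    by rewrite [Num.conj _%:C]conjc_real.
  + move=> s t z s' t' z' /matrixP e.
    have := e 0 i4_1; have := e 1 i4_3; have := e 1 i4_1.
    by rewrite !mxE /= => -> [->] [->].
- have := @chart_formula _ N omega mx14 (@mx14_rank2 R) (@mx14_sa R) HL i4_1 i4_2
    (@mx14_continuous R) (@mx14_boundary_form R) _ _ _ p lam y U Lambda oO sl ey ny sb.
  rewrite -/ybar Y1 Y2 Yb1 Yb2; apply.
  + move=> q h; matrix_entries;
      rewrite ?csD ?ctD ?czD ?rmorphD ?addr0 //= addrC //.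
  + move=> r s t z; matrix_entries; rewrite ?mulr0 ?rmorphM //=.
    by rewrite [Num.conj _%:C]conjc_real.
  + move=> s t z s' t' z' /matrixP e.
    have := e 0 i4_1; have := e 1 i4_2; have := e 1 i4_1.
    by rewrite !mxE /= => -> [->] [->].
- have := @chart_formula _ N omega mx23 (@mx23_rank2 R) (@mx23_sa R) HL i4_0 i4_3
    (@mx23_continuous R) (@mx23_boundary_form R) _ _ _ p lam y U Lambda oO sl ey ny sb.
  rewrite -/ybar Y0 Y3 Yb0 Yb3; apply.
  + move=> q h; matrix_entries;
      rewrite ?csD ?ctD ?czD ?rmorphD ?addr0 //= addrC //.
  + move=> r s t z; matrix_entries; rewrite ?mulr0 ?rmorphM //=.
    by rewrite [Num.conj _%:C]conjc_real.
  + move=> s t z s' t' z' /matrixP e.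
    have := e 0 i4_0; have := e 1 i4_3; have := e 1 i4_0.
    by rewrite !mxE /= => -> [->] [->].
- have := @chart_formula _ N omega mx24 (@mx24_rank2 R) (@mx24_sa R) HL i4_0 i4_2
    (@mx24_continuous R) (@mx24_boundary_form R) _ _ _ p lam y U Lambda oO sl ey ny sb.
  rewrite -/ybar Y0 Y2 Yb0 Yb2; apply.
  + move=> q h; matrix_entries;
      rewrite ?csD ?ctD ?czD ?rmorphD ?addr0 //= addrC //.
  + move=> r s t z; matrix_entries; rewrite ?mulr0 ?rmorphM //=.
    by rewrite [Num.conj _%:C]conjc_real.
  + move=> s t z s' t' z' /matrixP e.
    have := e 0 i4_0; have := e 1 i4_2; have := e 1 i4_0.
    by rewrite !mxE /= => -> [->] [->].
Qed.
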